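(* Let $A\in\mathcal L$, $b\in\mathbb R^m$, and let $x_\lambda=(A^\top A+\lambda^2L^\top L)^{-1}A^\top b=P(A,\lambda)A^\top b$ be the Tikhonov regularized solution of $\min_x\{\|Ax-b\|_2^2+\lambda^2\|Lx\|_2^2\}$. Write $A=\sum_{i=1}^k a_iS_i$ with $a=[a_1,\dots,a_k]^\top$, and $r_\lambda=b-Ax_\lambda$. Assume $Mx_\lambda\neq 0$ (and, for the formula for $c^{\mathsf{Reg}}_{\mathcal L}$, that every component of $Mx_\lambda$ is nonzero). Then the structured mixed, componentwise and normwise condition numbers are $$m^{\mathsf{Reg}}_{\mathcal L}(A,b)=\frac{\left\|\sum_{i=1}^k|a_i|\,\left|MP(A,\lambda)\left(A^\top S_ix_\lambda-S_i^\top r_\lambda\right)\right|+\left|MP(A,\lambda)A^\top\right||b|\right\|_\infty}{\|Mx_\lambda\|_\infty},$$ $$c^{\mathsf{Reg}}_{\mathcal L}(A,b)=\left\|\frac{\sum_{i=1}^k|a_i|\,\left|MP(A,\lambda)\left(A^\top S_ix_\lambda-S_i^\top r_\lambda\right)\right|+\left|MP(A,\lambda)A^\top\right||b|}{Mx_\lambda}\right\|_\infty,$$ $$\kappa^{\mathsf{Reg}}_{\mathcal L}(A,b)=\frac{\left\|MP(A,\lambda)\left[S_1^\top r_\lambda-A^\top S_1x_\lambda,\ \dots,\ S_k^\top r_\lambda-A^\top S_kx_\lambda,\ A^\top\right]\right\|_2\ \left\|\begin{bmatrix}a\\ b\end{bmatrix}\right\|_2}{\|Mx_\lambda\|_2}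.$$
   Context: Standing setting: $\lambda>0$ is fixed, $L\in\mathbb R^{p\times n}$ with $\mathrm{rank}(L)=p\le n\le m$, $A\in\mathbb R^{m\times n}$ with $\mathrm{rank}\begin{bmatrix}A\\ L\end{bmatrix}=n$, and $M\in\mathbb R^{l\times n}$ with $l\le n$. Put $P(A,\lambda)=(A^\top A+\lambda^2L^\top L)^{-1}$. $\mathcal L$ is a linear subspace of $\mathbb R^{m\times n}$ of dimension $k$ with basis $S_1,\dots,S_k$; $g:\mathbb R^k\to\mathcal L$ is the linear map $g(a)=\sum_{i=1}^k a_iS_i$. For perturbations $\Delta a\in\mathbb R^k$ of $a$ and $\Delta b\in\mathbb R^m$ of $b$, let $\Delta A=g(a+\Delta a)-g(a)=g(\Delta a)$ and $$\Delta x=\left[(A+\Delta A)^\top(A+\Delta A)+\lambda^2L^\top L\right]^{-1}(A+\Delta A)^\top(b+\Delta b)-x_\lambda .$$ The structured condition numbers are defined by $$m^{\mathsf{Reg}}_{\mathcal L}(A,b)=\lim_{\epsilon\to0}\ \sup_{|\Delta a|\le\epsilon|a|,\ |\Delta b|\le\epsilon|b|}\frac{\|M\Delta x\|_\infty}{\epsilon\|Mx_\lambda\|_\infty},\qquad c^{\mathsf{Reg}}_{\mathcal L}(A,b)=\lim_{\epsilon\to0}\ \sup_{|\Delta a|\le\epsilon|a|,\ |\Delta b|\le\epsilon|b|}\frac1\epsilon\left\|\frac{M\Delta x}{Mx_\lambda}\right\|_\infty,$$ $$\kappa^{\mathsf{Reg}}_{\mathcal L}(A,b)=\lim_{\epsilon\to0}\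 \sup_{\|[\Delta a;\Delta b]\|_2\le\epsilon\|[a;b]\|_2}\frac{\|M\Delta x\|_2}{\epsilon\|Mx_\lambda\|_2},$$ with $\epsilon\to0$ through positive values. Here $|\cdot|$ and $\le$ on vectors and matrices are entrywise, the quotient of two vectors is componentwise, $[x;y]$ is the column vector stacking $x$ on top of $y$, and $\|\cdot\|_2$ of a matrix is the spectral norm. *)

(* Defs.v *)
From HB Require Import structures.
From mathcomp Require Export all_boot all_order all_algebra.
From mathcomp Require Export all_classical all_reals all_analysis.

Set Implicit Arguments.
Unset Strict Implicit.
Unset Printing Implicit Defensive.

Export Order.TTheory GRing.Theory Num.Theory.
Export numFieldNormedType.Exports.

Local Open Scope classical_set_scope.
Local Open Scope ring_scope.

(* The infinity norm of a column vector v is the norm `|v| of the normed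
   module of matrices, i.e. the largest absolute value of an entry. *)

Section norms.
Context {R : realType}.

Definition absmx p q (B : 'M[R]_(p, q)) : 'M[R]_(p, q) := map_mx Num.norm B.

Definition lemx p q (B C : 'M[R]_(p, q)) : Prop := forall i j, B i j <= C i j.

Definition cdiv p (u v : 'cV[R]_p) : 'cV[R]_p := \col_i (u i 0 / v i 0).

Definition norm2 p (v : 'cV[R]_p) : R := Num.sqrt (\sum_i v i 0 ^+ 2).

(* The matrix norm induced by [norm2]. The set is nonempty and bounded above,
   so [sup] takes no default value. *)
Definition spectral_norm p q (B : 'M[R]_(p, q)) : R :=
  sup [set norm2 (B *m v) | v in [set v : 'cV[R]_q | norm2 v <= 1]].

End norms.

Section tikhonov.
Context {R : realType} {m n p : nat}.
Variables (lam : R) (L : 'M[R]_(p, n)).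

(* [invmx] is the identity on singular matrices. When [col_mx A L] has rank n
   and lam > 0, the matrix is invertible for A and for all matrices near A, so
   this convention does not affect the limits below. *)
Definition tikP (A : 'M[R]_(m, n)) : 'M[R]_n :=
  invmx (A^T *m A + lam ^+ 2 *: (L^T *m L)).

Definition tikhonov (A : 'M[R]_(m, n)) (b : 'cV[R]_m) : 'cV[R]_n :=
  tikP A *m A^T *m b.

End tikhonov.

Section structured_condition_numbers.
Context {R : realType} {m n p l k : nat}.
Variables (lam : R) (L : 'M[R]_(p, n)) (M : 'M[R]_(l, n)).
Variable S : k.-tuple 'M[R]_(m, n).

Definition lincomb (a : 'cV[R]_k) : 'M[R]_(m, n) :=
  \sum_(i < k) a i 0 *: tnth S i.

Variables (a : 'cV[R]_k) (b : 'cV[R]_m).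
Let A := lincomb a.
Let x := tikhonov lam L A b.

Definition deltaA (da : 'cV[R]_k) : 'M[R]_(m, n) :=
  lincomb (a + da) - lincomb a.

Definition deltax (d : 'cV[R]_k * 'cV[R]_m) : 'cV[R]_n :=
  tikhonov lam L (A + deltaA d.1) (b + d.2) - x.

Definition comp_pert (eps : R) : set ('cV[R]_k * 'cV[R]_m) :=
  [set d | lemx (absmx d.1) (eps *: absmx a) /\
           lemx (absmx d.2) (eps *: absmx b)].

Definition norm_pert (eps : R) : set ('cV[R]_k * 'cV[R]_m) :=
  [set d | norm2 (col_mx d.1 d.2) <= eps * norm2 (col_mx a b)].

(* The suprema are taken in the extended reals, so that an unbounded set of
   values has supremum +oo. *)
Definition mixed_sup (eps : R) : \bar R :=
  ereal_sup [set (`|M *m deltax d| / (eps * `|M *m x|))%:E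
            | d in comp_pert eps].

Definition comp_sup (eps : R) : \bar R :=
  ereal_sup [set (eps^-1 * `|cdiv (M *m deltax d) (M *m x)|)%:E
            | d in comp_pert eps].

Definition norm_sup (eps : R) : \bar R :=
  ereal_sup [set (norm2 (M *m deltax d) / (eps * norm2 (M *m x)))%:E
            | d in norm_pert eps].

Definition mixed_cond : \bar R := lim (mixed_sup eps @[eps --> 0^'+]).
Definition comp_cond : \bar R := lim (comp_sup eps @[eps --> 0^'+]).
Definition norm_cond : \bar R := lim (norm_sup eps @[eps --> 0^'+]).

End structured_condition_numbers.

(* Main.v *)
Require Import Defs.
From mathcomp Require Import ring lra.

Set Implicit Arguments.
Unset Strict Implicit.
Unset Printing Implicit Defensive.

Local Open Scope classical_set_scope.
Local Open Scope ring_scope.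

(** To first order in [d = (da, db)], the perturbation of the Tikhonov solution
    is
      [tik_diff d = P (D^T r + A^T (db - D x))] with [D = \sum_i da_i S_i],
    so [M *m tik_diff d = B *m col_mx da db] for the matrix
      [B = M P [S_i^T r - A^T S_i x | A^T]]  (lemma [tik_jacobianE]).
    Lemma [tikhonov_expansion] makes this quantitative: the error is at most
    [c t^2] when [|da|, |db| <= t] in the infinity norm and [t] is small. It
    rests on an exact identity: with [Q = A^T A + lam^2 L^T L] and [Q + E] its
    perturbation, [(Q + E) (deltax d - tik_diff d)] is a sum of terms that are
    all at least quadratic in [d] (lemma [tik_residualE]), and [Q + E] is
    boundedly invertible for small [E] because [Q] is invertible
    (lemma [unitmx_perturb]); invertibility of [Q] is where the rank condition
    on [A] stacked on [L] enters (lemma [tik_gram_unit]).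

    Consequently each supremum, divided by [eps], differs by [O(eps)] from the
    supremum of the same seminorm of [B v] over the admissible stacked
    perturbations [v], also divided by [eps]; as the admissible sets scale with
    [eps], the latter does not depend on [eps]
    (lemma [cvg_ereal_sup_first_order]). These linear suprema are explicit. Put
    [e = col_mx a b]. On the box [|v| <= eps |e|], the i-th entry of [B v] is
    at most [eps (|B| |e|)_i] in absolute value, with equality for a suitable
    choice of signs; and [|B| |e|] is the vector in the numerators of the mixed
    and componentwise formulas (lemma [absmx_tik_jacobianE]). The mixed case is
    the componentwise one with the constant vector [`|M x|] as denominator. On
    the ball [norm2 v <= eps * norm2 e], the supremum of [norm2 (B v)] is
    [eps * spectral_norm B * norm2 e] by definition of the spectral norm. *)

(** * The infinity norm of a matrix *)

Section matrix_norm.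
Context {R : realType}.

Lemma ler_entry_norm m n (A : 'M[R]_(m, n)) i j : `|A i j| <= `|A|.
Proof.
rewrite [leRHS]/Num.Def.normr /= mx_normrE.
by apply/bigmax_geP; right => /=; exists (i, j).
Qed.

Lemma norm_mx_le m n (A : 'M[R]_(m, n)) c :
  0 <= c -> (forall i j, `|A i j| <= c) -> `|A| <= c.
Proof.
move=> c0 h; rewrite [leLHS]/Num.Def.normr /= mx_normrE (bigmax_le _ c0)//=.
Qed.

Lemma norm_mulmx_le m n p (A : 'M[R]_(m, n)) (B : 'M[R]_(n, p)) :
  `|A *m B| <= n%:R * `|A| * `|B|.
Proof.
apply: norm_mx_le => [|i j]; first by rewrite !mulr_ge0.
rewrite mxE (le_trans (ler_norm_sum _ _ _))//.
rewrite (@le_trans _ _ (\sum_(k < n) `|A| * `|B|))//.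
  by apply: ler_sum => k _; rewrite normrM ler_pM// ler_entry_norm.
by rewrite sumr_const card_ord -mulrA mulr_natl.
Qed.

Lemma norm_trmx_le m n (A : 'M[R]_(m, n)) : `|A^T| <= `|A|.
Proof. by apply: norm_mx_le => // i j; rewrite mxE ler_entry_norm. Qed.

End matrix_norm.

(** * The Euclidean and spectral norms *)

Section euclidean_norm.
Context {R : realType}.

Lemma norm2_ge0 n (u : 'cV[R]_n) : 0 <= norm2 u.
Proof. exact: sqrtr_ge0. Qed.

Lemma sqr_norm2 n (u : 'cV[R]_n) : norm2 u ^+ 2 = \sum_i u i 0 ^+ 2.
Proof. by rewrite sqr_sqrtr// sumr_ge0// => i _; rewrite sqr_ge0. Qed.

Lemma ler_entry_norm2 n (u : 'cV[R]_n) i : `|u i 0| <= norm2 u.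
Proof.
rewrite -sqrtr_sqr ler_sqrt; last by apply: sumr_ge0 => j _; rewrite sqr_ge0.
by rewrite (bigD1 i)//= lerDl sumr_ge0// => j _; rewrite sqr_ge0.
Qed.

Lemma ler_norm_norm2 n (u : 'cV[R]_n) : `|u| <= norm2 u.
Proof.
apply: norm_mx_le => [|i j]; first exact: norm2_ge0.
by rewrite (ord1 j) ler_entry_norm2.
Qed.

Lemma norm2_eq0 n (u : 'cV[R]_n) : norm2 u = 0 -> u = 0.
Proof.
move=> u0; apply/matrixP => i j; rewrite (ord1 j) !mxE; apply/eqP.
by rewrite -normr_le0 -u0 ler_entry_norm2.
Qed.

Lemma norm2Z n c (u : 'cV[R]_n) : norm2 (c *: u) = `|c| * norm2 u.
Proof.
rewrite /norm2 -sqrtr_sqr -sqrtrM ?sqr_ge0//; congr Num.sqrt.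
by rewrite mulr_sumr; apply: eq_bigr => i _; rewrite mxE exprMn.
Qed.

Lemma cauchy_schwarz_norm2 n (u v : 'cV[R]_n) :
  \sum_i u i 0 * v i 0 <= norm2 u * norm2 v.
Proof.
have [u0|un0] := eqVneq (norm2 u) 0.
  by rewrite u0 mul0r (norm2_eq0 u0) big1// => i _; rewrite mxE mul0r.
have [v0|vn0] := eqVneq (norm2 v) 0.
  by rewrite v0 mulr0 (norm2_eq0 v0) big1// => i _; rewrite mxE mulr0.
have uv_gt0 : 0 < norm2 u * norm2 v.
  by rewrite mulr_gt0// lt_neqAle eq_sym ?un0 ?vn0 norm2_ge0.
have : 0 <= \sum_i (norm2 v * u i 0 - norm2 u * v i 0) ^+ 2.
  by apply: sumr_ge0 => i _; rewrite sqr_ge0.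
rewrite (eq_bigr (fun i => norm2 v ^+ 2 * u i 0 ^+ 2 +
  norm2 u ^+ 2 * v i 0 ^+ 2 - 2 * (norm2 u * norm2 v) * (u i 0 * v i 0)));
  last by move=> i _; ring.
rewrite !big_split/= sumrN -!mulr_sumr -!sqr_norm2.
set s := \sum_i _ => h; rewrite -(ler_pM2l uv_gt0); nra.
Qed.

Lemma norm2D n (u v : 'cV[R]_n) : norm2 (u + v) <= norm2 u + norm2 v.
Proof.
rewrite -(@ler_pXn2r _ 2)// ?nnegrE ?addr_ge0 ?norm2_ge0//.
rewrite sqr_norm2 (eq_bigr (fun i => u i 0 ^+ 2 + v i 0 ^+ 2 +
  2 * (u i 0 * v i 0))); last by move=> i _; rewrite mxE; ring.
rewrite !big_split/= -mulr_sumr -!sqr_norm2.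
have := cauchy_schwarz_norm2 u v; nra.
Qed.

Lemma norm2_le_norm n (u : 'cV[R]_n) : norm2 u <= n%:R * `|u|.
Proof.
rewrite -(@ler_pXn2r _ 2)// ?nnegrE ?mulr_ge0 ?norm2_ge0//.
rewrite sqr_norm2 (@le_trans _ _ (\sum_(i < n) `|u| ^+ 2))//.
  apply: ler_sum => i _; rewrite -real_normK ?num_real//.
  by rewrite ler_pXn2r ?nnegrE// ler_entry_norm.
rewrite sumr_const card_ord exprMn -[leLHS]mulr_natl ler_wpM2r ?sqr_ge0//.
by rewrite -natrX ler_nat; case: (n) => // k; rewrite leq_pmulr.
Qed.

Lemma norm2_lipschitz n (u v : 'cV[R]_n) :
  norm2 u <= norm2 v + n%:R * `|u - v|.
Proof.
rewrite -{1}(subrK v u) addrC (le_trans (norm2D _ _))//.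
by rewrite lerD2l norm2_le_norm.
Qed.

Lemma has_sup_spectral p q (B : 'M[R]_(p, q)) :
  has_sup [set norm2 (B *m v) | v in [set v : 'cV[R]_q | norm2 v <= 1]].
Proof.
split.
  exists (norm2 (B *m 0)); exists 0 => //=.
  by rewrite /norm2 big1 ?sqrtr0// => i _; rewrite mxE expr0n.
exists (p%:R * (q%:R * `|B|)) => _ [v /= v1 <-].
rewrite (le_trans (norm2_le_norm _))// ler_wpM2l//.
rewrite (le_trans (norm_mulmx_le _ _))// ler_piMr ?mulr_ge0//.
exact: le_trans (ler_norm_norm2 _) v1.
Qed.

Lemma spectral_norm_ge0 p q (B : 'M[R]_(p, q)) : 0 <= spectral_norm B.
Proof.
apply: le_trans (norm2_ge0 (B *m 0)) (sup_upper_bound (has_sup_spectral B) _).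
by exists 0 => //=; rewrite /norm2 big1 ?sqrtr0// => i _; rewrite mxE expr0n.
Qed.

Lemma spectral_norm_ub p q (B : 'M[R]_(p, q)) (v : 'cV[R]_q) :
  norm2 (B *m v) <= spectral_norm B * norm2 v.
Proof.
have [v0|vn0] := eqVneq (norm2 v) 0.
  rewrite v0 (norm2_eq0 v0) mulmx0 mulr0.
  by rewrite /norm2 big1 ?sqrtr0// => i _; rewrite mxE expr0n.
have v_gt0 : 0 < norm2 v by rewrite lt_neqAle eq_sym vn0 norm2_ge0.
rewrite -ler_pdivrMr// mulrC.
rewrite -[X in X * _]gtr0_norm ?invr_gt0// -norm2Z scalemxAr.
apply: sup_upper_bound; first exact: has_sup_spectral.
exists ((norm2 v)^-1 *: v) => //=.
by rewrite norm2Z gtr0_norm ?invr_gt0// mulVf.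
Qed.

Lemma spectral_norm_approx p q (B : 'M[R]_(p, q)) e : 0 < e ->
  exists2 v : 'cV[R]_q, norm2 v <= 1 & spectral_norm B - e < norm2 (B *m v).
Proof.
move=> e0; have [_ [v v1 <-] h] := sup_adherent e0 (has_sup_spectral B).
by exists v.
Qed.

End euclidean_norm.

(** * Linear maps on a componentwise box *)

Section componentwise_box.
Context {R : realType}.

Lemma absmx_mulmx_box p q (B : 'M[R]_(p, q)) (e v : 'cV[R]_q) eps i :
  lemx (absmx v) (eps *: absmx e) ->
  `|(B *m v) i 0| <= eps * (absmx B *m absmx e) i 0.
Proof.
move=> h; rewrite !mxE (le_trans (ler_norm_sum _ _ _))// mulr_sumr.
apply: ler_sum => j _; have := h j 0; rewrite !mxE normrM mulrCA => hj.
by rewrite ler_wpM2l.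
Qed.

(** The maximizing perturbation, whose signs are those of row [i] of [B],
    depends on [i]. *)
Lemma absmx_mulmx_box_attained p q (B : 'M[R]_(p, q)) (e : 'cV[R]_q) eps i :
  0 <= eps -> exists2 v : 'cV[R]_q, lemx (absmx v) (eps *: absmx e) &
    (B *m v) i 0 = eps * (absmx B *m absmx e) i 0.
Proof.
move=> eps0; exists (\col_j (eps * (Num.sg (B i j) * `|e j 0|))).
  move=> j j0; rewrite (ord1 j0) !mxE !normrM normr_id ger0_norm//.
  by rewrite ler_wpM2l// ler_piMl// normr_sg lern1 leq_b1.
rewrite !mxE mulr_sumr; apply: eq_bigr => j _; rewrite !mxE.
by rewrite [`|B i j|]normrEsg; ring.
Qed.

Lemma norm_cdiv_mono p (u v w : 'cV[R]_p) c : 0 <= c ->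
  (forall i, `|u i 0| <= c * v i 0) -> `|cdiv u w| <= c * `|cdiv v w|.
Proof.
move=> c0 h; apply: norm_mx_le => [|i j]; first by rewrite mulr_ge0.
rewrite mxE normrM (@le_trans _ _ (c * `|(cdiv v w) i 0|))//; last first.
  by rewrite ler_wpM2l// ler_entry_norm.
rewrite mxE normrM mulrA ler_wpM2r// (le_trans (h i))// ler_wpM2l//.
exact: ler_norm.
Qed.

Lemma norm_attained p (u : 'cV[R]_p) : u != 0 -> exists i, `|u| = `|u i 0|.
Proof.
move=> u0; have : mx_norm u != 0 by apply: contra_neq u0 => /mx_norm_eq0.
by move=> /mx_norm_neq0[[i j]] /=; rewrite (ord1 j); exists i.
Qed.

Lemma cdiv_lipschitz p (u v w : 'cV[R]_p) :
  `|cdiv u w| <= `|cdiv v w| + `|cdiv (const_mx 1) w| * `|u - v|.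
Proof.
apply: norm_mx_le => [|i j]; first by rewrite addr_ge0// mulr_ge0.
have -> : cdiv u w i j = cdiv v w i j + cdiv (const_mx 1) w i j * (u - v) i 0.
  by rewrite !mxE; ring.
rewrite (le_trans (ler_normD _ _))// lerD ?ler_entry_norm//.
by rewrite normrM ler_pM// ler_entry_norm.
Qed.

End componentwise_box.

(** * Limits of suprema of first-order quotients *)

Section limit_of_suprema.
Context {R : realType}.

(** Replacing [G] by a first-order approximation [H] does not change the limit
    of the normalized suprema. The lower bound only asks for near-maximizers of
    [H], up to [eps ^+ 2], so that the supremum need not be attained. *)
Lemma cvg_ereal_sup_first_order (D : Type) l (X : R -> set D)
    (phi : 'cV[R]_l -> R) (G H : D -> 'cV[R]_l) (v K c delta : R) :
  0 < delta -> 0 <= K ->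
  (forall u w, phi u <= phi w + K * `|u - w|) ->
  (forall eps d, 0 < eps <= delta -> X eps d ->
     `|G d - H d| <= c * eps ^+ 2) ->
  (forall eps d, 0 < eps -> X eps d -> phi (H d) <= eps * v) ->
  (forall eps, 0 < eps ->
     exists2 d, X eps d & eps * v - eps ^+ 2 <= phi (H d)) ->
  ereal_sup [set (eps^-1 * phi (G d))%:E | d in X eps] @[eps --> 0^'+]
    --> v%:E.
Proof.
move=> delta0 K0 lip GH ub lb.
have lin s : (v + s * eps)%:E @[eps --> 0^'+] --> v%:E.
  apply: cvg_EFin; first by near=> x.
  rewrite [X in X @ _](_ : _ = fun eps => v + s * eps)//.
  apply: cvg_at_right_filter.
  rewrite -[X in _ --> X]addr0 -[X in _ + X](mulr0 s).
  apply: cvgD; [exact: cvg_cst | apply: cvgM; [exact: cvg_cst | exact: cvg_id]].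
apply: (squeeze_cvge _ (lin (- (K * c + 1))) (lin (K * c))).
near=> eps.
have eps0 : 0 < eps by near: eps; exact: nbhs_right_gt.
have epsd : eps <= delta by near: eps; exact: nbhs_right_le.
have epsR : 0 < eps <= delta by rewrite eps0.
apply/andP; split.
  have [d Xd hd] := lb _ eps0.
  apply: le_trans (ereal_sup_ubound _); last by exists d.
  rewrite lee_fin [leRHS]mulrC ler_pdivlMr//.
  have := lip (H d) (G d); have := GH _ _ epsR Xd.
  rewrite distrC => h1 h2.
  have := ler_wpM2l K0 h1; nra.
apply: ge_ereal_sup => _ [d Xd <-].
rewrite lee_fin [leLHS]mulrC ler_pdivrMr//.
have := lip (G d) (H d); have := GH _ _ epsR Xd => h1 h2.
have := ub _ _ eps0 Xd; have := ler_wpM2l K0 h1; nra.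
Unshelve. all: by end_near.
Qed.

End limit_of_suprema.

(** * Perturbation of an invertible matrix and of the normal equations *)

Section perturbation.
Context {R : realType}.

Lemma unitmx_perturb n (Q E : 'M[R]_n) : Q \in unitmx ->
  n%:R * `|invmx Q| * (n%:R * `|E|) <= 2^-1 ->
  Q + E \in unitmx /\
  forall w : 'cV[R]_n, `|w| <= 2 * (n%:R * `|invmx Q|) * `|(Q + E) *m w|.
Proof.
move=> uQ small.
(* w = Q^-1 ((Q + E) w - E w), and the term in E w is at most half of w *)
have bound (w : 'cV[R]_n) :
    `|w| <= 2 * (n%:R * `|invmx Q|) * `|(Q + E) *m w|.
  have {1}-> : w = invmx Q *m ((Q + E) *m w - E *m w).
    by rewrite mulmxDl addrK mulKmx.
  have := norm_mulmx_le (invmx Q) ((Q + E) *m w - E *m w).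
  have {1 2}-> : invmx Q *m ((Q + E) *m w - E *m w) = w.
    by rewrite mulmxDl addrK mulKmx.
  have h1 := ler_normB ((Q + E) *m w) (E *m w).
  have h2 := norm_mulmx_le E w.
  have P0 : 0 <= n%:R * `|invmx Q| by rewrite mulr_ge0.
  have h3 := ler_wpM2l P0 (le_trans h1 (lerD (lexx _) h2)).
  have h4 := ler_wpM2r (normr_ge0 w) small.
  move=> h5; have := le_trans h5 h3; nra.
split=> //; rewrite -unitmx_tr -row_free_unit; apply: inj_row_free => v v0.
have w0 : (Q + E) *m v^T = 0 by rewrite -[Q + E]trmxK -trmx_mul v0 trmx0.
have := bound v^T; rewrite w0 normr0 mulr0 normr_le0 => /eqP v'0.
by rewrite -[v]trmxK v'0 trmx0.
Qed.

Lemma normal_equation_diff m n (A D : 'M[R]_(m, n)) (x : 'cV[R]_n)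
    (b db : 'cV[R]_m) :
  (A + D)^T *m (b + db) - (A^T *m b + (A^T *m D + D^T *m (A + D)) *m x)
    - (D^T *m (b - A *m x) + A^T *m (db - D *m x)) = D^T *m (db - D *m x).
Proof.
rewrite [(A + D)^T]linearD/= !(mulmxDl, mulmxDr, mulmxN) !mulmxA.
move: (A^T *m b) (A^T *m db) (D^T *m b) (D^T *m db) => u1 u2 u3 u4.
move: (A^T *m D *m x) (D^T *m A *m x) (D^T *m D *m x) => u5 u6 u7.
by apply/matrixP => i j; rewrite !mxE; ring.
Qed.

End perturbation.

(** * Orders of smallness *)

Section order_of_smallness.
Context {R : realType} {V1 V2 : normedModType R}.

(** [f d] is [O(t ^+ e)], uniformly for [t] in [[0, 1]] and for [d] with both
    components of norm at most [t]. Working with an explicit radius [t], rather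
    than with the norm of [d], gives bounds that are uniform over the
    perturbation sets. *)
Definition small_of_order p q (e : nat) (f : V1 * V2 -> 'M[R]_(p, q)) :=
  exists2 C : R, 0 <= C & forall d t, 0 <= t <= 1 ->
    `|d.1| <= t -> `|d.2| <= t -> `|f d| <= C * t ^+ e.

Lemma small_cst p q (B : 'M[R]_(p, q)) : small_of_order 0 (fun=> B).
Proof. by exists `|B| => // d t _ _ _; rewrite mulr1. Qed.

Lemma small_weaken p q e (f : V1 * V2 -> 'M[R]_(p, q)) :
  small_of_order e.+1 f -> small_of_order e f.
Proof.
move=> [C C0 h]; exists C => // d t /[dup] t01 /andP[t0 t1] d1 d2.
rewrite (le_trans (h _ _ t01 d1 d2))// ler_wpM2l// exprS ler_piMl//.
exact: exprn_ge0.
Qed.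

Lemma small_tr p q e (f : V1 * V2 -> 'M[R]_(p, q)) :
  small_of_order e f -> small_of_order e (fun d => (f d)^T).
Proof.
move=> [C C0 h]; exists C => // d t t01 d1 d2.
by rewrite (le_trans (norm_trmx_le _))// h.
Qed.

Lemma smallD p q e (f g : V1 * V2 -> 'M[R]_(p, q)) :
  small_of_order e f -> small_of_order e g ->
  small_of_order e (fun d => f d + g d).
Proof.
move=> [C C0 h] [C' C0' h']; exists (C + C') => [|d t t01 d1 d2].
  by rewrite addr_ge0.
by rewrite (le_trans (ler_normD _ _))// mulrDl lerD// ?h ?h'.
Qed.

Lemma smallB p q e (f g : V1 * V2 -> 'M[R]_(p, q)) :
  small_of_order e f -> small_of_order e g ->
  small_of_order e (fun d => f d - g d).
Proof.
move=> [C C0 h] [C' C0' h']; exists (C + C') => [|d t t01 d1 d2].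
  by rewrite addr_ge0.
by rewrite (le_trans (ler_normB _ _))// mulrDl lerD// ?h ?h'.
Qed.

Lemma smallM p q s e e' (f : V1 * V2 -> 'M[R]_(p, q))
    (g : V1 * V2 -> 'M[R]_(q, s)) :
  small_of_order e f -> small_of_order e' g ->
  small_of_order (e + e') (fun d => f d *m g d).
Proof.
move=> [C C0 h] [C' C0' h']; exists (q%:R * C * C') => [|d t t01 d1 d2].
  by rewrite !mulr_ge0.
rewrite (le_trans (norm_mulmx_le _ _))// -!mulrA ler_wpM2l//.
rewrite (_ : C * _ = (C * t ^+ e) * (C' * t ^+ e'));
  last by rewrite exprD; ring.
by rewrite ler_pM// ?h ?h'.
Qed.

End order_of_smallness.

(** * First-order expansion of the Tikhonov solution *)

Section tikhonov_expansion.
Context {R : realType} {m n p k : nat}.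
Variables (lam : R) (L : 'M[R]_(p, n)) (S : k.-tuple 'M[R]_(m, n)).
Variables (a : 'cV[R]_k) (b : 'cV[R]_m).

Lemma lincombD (u v : 'cV[R]_k) : lincomb S (u + v) = lincomb S u + lincomb S v.
Proof.
by rewrite -big_split/=; apply: eq_bigr => i _; rewrite mxE scalerDl.
Qed.

Lemma deltaA_lincomb (da : 'cV[R]_k) : deltaA S a da = lincomb S da.
Proof. by rewrite /deltaA lincombD addrC addKr. Qed.

Lemma small_lincomb :
  small_of_order 1 (fun d : 'cV[R]_k * 'cV[R]_m => lincomb S d.1).
Proof.
exists (\sum_(i < k) `|tnth S i|) => [|d t _ d1 _]; first exact: sumr_ge0.
rewrite (le_trans (ler_norm_sum _ _ _))// expr1 mulr_suml.
apply: ler_sum => i _; rewrite normrZ mulrC ler_wpM2l//.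
exact: le_trans (ler_entry_norm _ _ _) d1.
Qed.

Lemma small_snd : small_of_order 1 (fun d : 'cV[R]_k * 'cV[R]_m => d.2).
Proof. by exists 1 => // d t _ _; rewrite mul1r. Qed.

(** If the row vector [w^T] is in the kernel, then the quadratic form
    [norm2 (A w) ^+ 2 + lam ^+ 2 * norm2 (L w) ^+ 2] vanishes, hence so do
    [A w] and [L w]. *)
Lemma tik_gram_unit (A : 'M[R]_(m, n)) : 0 < lam -> \rank (col_mx A L) = n ->
  A^T *m A + lam ^+ 2 *: (L^T *m L) \in unitmx.
Proof.
move=> lam0 rk; rewrite -row_free_unit; apply: inj_row_free => v.
pose w := v^T => vQ.
have sqr q (B : 'M[R]_(q, n)) :
    (v *m (B^T *m B) *m w) 0 0 = norm2 (B *m w) ^+ 2.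
  rewrite sqr_norm2 (_ : _ *m w = (B *m w)^T *m (B *m w)).
    by rewrite mxE; apply: eq_bigr => i _; rewrite mxE expr2.
  by rewrite trmx_mul trmxK !mulmxA.
have : (v *m (A^T *m A + lam ^+ 2 *: (L^T *m L)) *m w) 0 0 = 0.
  by rewrite vQ mul0mx mxE.
rewrite mulmxDr mulmxDl -scalemxAr -scalemxAl mxE [X in _ + X]mxE !sqr => h0.
have hA : norm2 (A *m w) = 0.
  apply/eqP; rewrite -sqrf_eq0 eq_le sqr_ge0 andbT -h0 lerDl.
  by rewrite mulr_ge0// sqr_ge0.
have hL : norm2 (L *m w) = 0.
  move/eqP: h0; rewrite hA expr0n add0r mulf_eq0 !sqrf_eq0.
  by rewrite gt_eqF//= => /eqP.
have free : row_free (col_mx A L)^T by rewrite /row_free mxrank_tr rk.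
apply: (row_free_inj free).
rewrite mul0mx -[v]trmxK -trmx_mul mul_col_mx -/w.
by rewrite (norm2_eq0 hA) (norm2_eq0 hL) col_mx0 trmx0.
Qed.

Let A := lincomb S a.
Let x := tikhonov lam L A b.
Let r := b - A *m x.

(** The differential of the Tikhonov solution with respect to [(a, b)]. *)
Definition tik_diff (d : 'cV[R]_k * 'cV[R]_m) : 'cV[R]_n :=
  tikP lam L A *m ((lincomb S d.1)^T *m r + A^T *m (d.2 - lincomb S d.1 *m x)).

Lemma small_tik_diff : small_of_order 1 tik_diff.
Proof.
apply: (smallM (e := 0) (small_cst _)); apply: smallD.
  exact: (smallM (e' := 0) (small_tr small_lincomb) (small_cst _)).
apply: (smallM (e := 0) (small_cst _)); apply: smallB; first exact: small_snd.
exact: (smallM (e' := 0) small_lincomb (small_cst _)).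
Qed.

Let Q := A^T *m A + lam ^+ 2 *: (L^T *m L).
(* E is the perturbation of the matrix Q, and z the part of the perturbed
   normal equations that the linearization leaves over. *)
Let E (d : 'cV[R]_k * 'cV[R]_m) :=
  A^T *m lincomb S d.1 + (lincomb S d.1)^T *m (A + lincomb S d.1).
Let z (d : 'cV[R]_k * 'cV[R]_m) :=
  (lincomb S d.1)^T *m (d.2 - lincomb S d.1 *m x) - E d *m tik_diff d.

Lemma small_gram_diff : small_of_order 1 E.
Proof.
apply: smallD; first exact: (smallM (e := 0) (small_cst _) small_lincomb).
apply: (smallM (e' := 0) (small_tr small_lincomb)).
by apply: smallD; [exact: small_cst|exact/small_weaken/small_lincomb].
Qed.

Lemma small_tik_residual : small_of_order 2 z.
Proof.
apply: smallB; last exact: smallM small_gram_diff small_tik_diff.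
apply: (smallM (e := 1) (e' := 1)); first exact/small_tr/small_lincomb.
apply: smallB; first exact: small_snd.
exact: (smallM (e' := 0) small_lincomb (small_cst _)).
Qed.

(** Subtracting the normal equations of the perturbed and of the unperturbed
    problem shows that the linearization error of the solution solves the
    perturbed normal equations with right-hand side [z]. *)
Lemma tik_residualE d : Q \in unitmx -> Q + E d \in unitmx ->
  (Q + E d) *m (deltax lam L S a b d - tik_diff d) = z d.
Proof.
set D := lincomb S d.1 => uQ uQE.
have QEE : Q + E d = (A + D)^T *m (A + D) + lam ^+ 2 *: (L^T *m L).
  rewrite /Q /E -/D [(A + D)^T]raddfD mulmxDl !mulmxDr.
  rewrite -[RHS]addrA [X in _ = _ + X]addrC.
  rewrite -[LHS]addrA [X in _ + X = _]addrC -!addrA.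
  by rewrite [X in _ = _ + (_ + X)]addrC -!addrA.
have Qx : Q *m x = A^T *m b by rewrite /x /tikhonov -mulmxA mulKVmx.
have QJ : Q *m tik_diff d = D^T *m r + A^T *m (d.2 - D *m x).
  by rewrite mulKVmx.
rewrite /deltax deltaA_lincomb -/A -/D -/x.
have Qx' : (Q + E d) *m tikhonov lam L (A + D) (b + d.2) =
    (A + D)^T *m (b + d.2).
  by rewrite /tikhonov /tikP -QEE -mulmxA mulKVmx.
rewrite !mulmxBr Qx' (mulmxDl Q (E d) x) Qx (mulmxDl Q (E d) (tik_diff d)) QJ.
have subD (u v w : 'cV[R]_n) : u - (v + w) = u - v - w.
  by rewrite opprD addrA.
by rewrite subD normal_equation_diff.
Qed.

(** The map [d |-> deltax d] is differentiable at 0 with derivative [tik_diff],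
    with a quadratic error bound. *)
Lemma tikhonov_expansion : Q \in unitmx -> exists c delta : R,
  [/\ 0 < delta, 0 <= c & forall d t, 0 <= t <= delta ->
     `|d.1| <= t -> `|d.2| <= t ->
     `|deltax lam L S a b d - tik_diff d| <= c * t ^+ 2].
Proof.
move=> uQ; have [CE CE0 hE] := small_gram_diff.
have [Cz Cz0 hz] := small_tik_residual.
pose P := n%:R * `|invmx Q|.
have P0 : 0 <= P by rewrite mulr_ge0.
pose B := P * (n%:R * CE).
have B0 : 0 <= B by rewrite !mulr_ge0.
have B1 : 0 < 2 * B + 1 by rewrite ltr_wpDl// mulr_ge0.
(* this radius is at most 1 and makes P n |E d| <= B t <= 1 / 2 *)
exists (2 * P * Cz), (2 * B + 1)^-1; split; first by rewrite invr_gt0.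
  by rewrite !mulr_ge0.
move=> d t /andP[t0 td] d1 d2.
have tB : t * (2 * B + 1) <= 1 by rewrite -ler_pdivlMr// div1r.
have t01 : 0 <= t <= 1 by rewrite t0 /=; nra.
have small : P * (n%:R * `|E d|) <= 2^-1.
  apply: (@le_trans _ _ (B * t)); last by nra.
  rewrite /B -!mulrA ler_wpM2l// ler_wpM2l//.
  by have := hE _ _ t01 d1 d2; rewrite expr1 => hEd; rewrite ler_wpM2l.
have [u bound] := unitmx_perturb uQ small.
rewrite (le_trans (bound _))// tik_residualE// -[leRHS]mulrA.
by rewrite ler_wpM2l ?hz// mulr_ge0.
Qed.

(** The matrix of the map [d |-> M *m tik_diff d] on stacked vectors. *)
Definition tik_jacobian l (M : 'M[R]_(l, n)) : 'M[R]_(l, k + m) :=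
  M *m tikP lam L A *m row_mx (\matrix_(j < n, i < k)
    ((tnth S i)^T *m r - A^T *m tnth S i *m x) j 0) A^T.

Lemma tik_jacobianE l (M : 'M[R]_(l, n)) d :
  M *m tik_diff d = tik_jacobian M *m col_mx d.1 d.2.
Proof.
rewrite /tik_jacobian /tik_diff -!mulmxA mul_row_col; do 2!congr (_ *m _).
rewrite [X in _ + X = _]mulmxBr addrA addrAC; congr (_ + _).
apply/matrixP => i j; rewrite (ord1 j) /lincomb linear_sum/= mulmx_suml.
rewrite mulmx_suml mulmx_sumr -sumrB summxE mxE; apply: eq_bigr => h _.
rewrite linearZ/= -!scalemxAl -scalemxAr -scalerBr mulmxA.
by rewrite [LHS]mxE [in RHS]mxE mulrC.
Qed.

(** The numerator of the mixed and componentwise condition numbers, in terms of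
    the Jacobian. The opposite sign of its first [k] columns disappears in
    [absmx]. *)
Lemma absmx_tik_jacobianE l (M : 'M[R]_(l, n)) :
  \sum_(i < k) `|a i 0| *: absmx (M *m tikP lam L A *m
      (A^T *m tnth S i *m x - (tnth S i)^T *m r))
    + absmx (M *m tikP lam L A *m A^T) *m absmx b =
  absmx (tik_jacobian M) *m absmx (col_mx a b).
Proof.
rewrite /tik_jacobian mul_mx_row /absmx map_row_mx map_col_mx mul_row_col.
congr (_ + _); apply/matrixP => i j; rewrite (ord1 j) summxE mxE.
apply: eq_bigr => h _; rewrite !mxE mulrC; congr (_ * _).
rewrite -normrN -sumrN; congr (`| _ |); apply: eq_bigr => c _.
rewrite -mulrN; congr (_ * _); rewrite [RHS]mxE.
by rewrite !mxE opprB.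
Qed.

End tikhonov_expansion.

(** * The structured condition numbers *)

Lemma comp_pertE (R : realType) m k (a : 'cV[R]_k) (b : 'cV[R]_m) eps d :
  comp_pert a b eps d <->
  lemx (absmx (col_mx d.1 d.2)) (eps *: absmx (col_mx a b)).
Proof.
rewrite /absmx !map_col_mx scale_col_mx; split=> [[d1 d2] i j|h].
  by case: (split_ordP i) => h ->; rewrite ?col_mxEu ?col_mxEd.
by split=> i j; [have := h (lshift m i) j; rewrite !col_mxEu
                |have := h (rshift k i) j; rewrite !col_mxEd].
Qed.

Theorem theorem1 (R : realType) (m n p l k : nat) (lam : R)
    (L : 'M[R]_(p, n)) (A : 'M[R]_(m, n)) (M : 'M[R]_(l, n))
    (W : {vspace 'M[R]_(m, n)}) (S : k.-tuple 'M[R]_(m, n))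
    (a : 'cV[R]_k) (b : 'cV[R]_m)
    (lam_gt0 : 0 < lam)
    (rankL : \rank L = p) (le_pn : (p <= n)%N) (le_nm : (n <= m)%N)
    (rankAL : \rank (col_mx A L) = n) (le_ln : (l <= n)%N)
    (dimW : \dim W = k) (basisS : basis_of W S)
    (AW : A \in W) (Aa : A = \sum_(i < k) a i 0 *: tnth S i) :
  let P := tikP lam L A in
  let x := tikhonov lam L A b in
  let r := b - A *m x in
  let N := \sum_(i < k) `|a i 0| *:
               absmx (M *m P *m (A^T *m tnth S i *m x - (tnth S i)^T *m r))
           + absmx (M *m P *m A^T) *m absmx b in
  let T := \matrix_(j < n, i < k)
               ((tnth S i)^T *m r - A^T *m tnth S i *m x) j 0 in
  M *m x != 0 ->
  [/\ cvg (mixed_sup lam L M S a b eps @[eps --> 0^'+]) /\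
      mixed_cond lam L M S a b = (`|N| / `|M *m x|)%:E,
      (forall i, (M *m x) i 0 != 0) ->
      cvg (comp_sup lam L M S a b eps @[eps --> 0^'+]) /\
      comp_cond lam L M S a b = `|cdiv N (M *m x)|%:E &
      cvg (norm_sup lam L M S a b eps @[eps --> 0^'+]) /\
      norm_cond lam L M S a b =
        (spectral_norm (M *m P *m row_mx T A^T) * norm2 (col_mx a b)
         / norm2 (M *m x))%:E].
Proof.
move=> P x r N T Mx0; subst A.
pose B := tik_jacobian lam L S a b M.
pose e := col_mx a b.
have uQ := tik_gram_unit lam_gt0 rankAL.
have NE : N = absmx B *m absmx e by exact: absmx_tik_jacobianE.
have [c [delta [delta0 c0 rem]]] := tikhonov_expansion b uQ.
(* It remains to compute the suprema of the linear map B: this holds for every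
   family X of perturbation sets of radius O(eps). *)
have first_order (X : R -> set ('cV[R]_k * 'cV[R]_m)) rho :
    0 <= rho ->
    (forall eps d, 0 < eps -> X eps d ->
       `|d.1| <= eps * rho /\ `|d.2| <= eps * rho) ->
    forall (phi : 'cV[R]_l -> R) v K, 0 <= K ->
    (forall u w, phi u <= phi w + K * `|u - w|) ->
    (forall eps d, 0 < eps -> X eps d ->
       phi (B *m col_mx d.1 d.2) <= eps * v) ->
    (forall eps, 0 < eps -> exists2 d, X eps d &
       eps * v - eps ^+ 2 <= phi (B *m col_mx d.1 d.2)) ->
    ereal_sup [set (eps^-1 * phi (M *m deltax lam L S a b d))%:E
              | d in X eps] @[eps --> 0^'+] --> v%:E.
  move=> rho0 hX phi v K K0 lip ub lb.
  apply: (@cvg_ereal_sup_first_order _ _ _ X phi _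
    (fun d => B *m col_mx d.1 d.2) v K (n%:R * `|M| * (c * rho ^+ 2))
    (delta / (rho + 1))) => //.
    by rewrite divr_gt0// ltr_wpDl.
  move=> eps d /andP[eps0]; rewrite ler_pdivlMr ?ltr_wpDl// => epsd Xd.
  rewrite -tik_jacobianE -mulmxBr (le_trans (norm_mulmx_le _ _))//.
  rewrite -[leRHS]mulrA ler_wpM2l ?mulr_ge0//.
  rewrite -[leRHS]mulrA -exprMn [rho * _]mulrC.
  have [d1 d2] := hX _ _ eps0 Xd.
  by apply: rem => //; rewrite mulr_ge0 ?(ltW eps0)//=; nra.
have comp_small eps (d : 'cV[R]_k * 'cV[R]_m) : 0 < eps ->
    comp_pert a b eps d -> `|d.1| <= eps * (`|a| + `|b|) /\
    `|d.2| <= eps * (`|a| + `|b|).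
  move=> eps0 [d1 d2]; split; apply: norm_mx_le => [|i j];
    rewrite ?mulr_ge0 ?addr_ge0 ?(ltW eps0)//.
    have := d1 i j; rewrite !mxE => /le_trans; apply.
    rewrite ler_wpM2l ?(ltW eps0)//.
    by rewrite (le_trans (ler_entry_norm _ _ _))// lerDl.
  have := d2 i j; rewrite !mxE => /le_trans; apply.
  rewrite ler_wpM2l ?(ltW eps0)//.
  by rewrite (le_trans (ler_entry_norm _ _ _))// lerDr.
have comp_first_order (w : 'cV[R]_l) :
    ereal_sup [set (eps^-1 * `|cdiv (M *m deltax lam L S a b d) w|)%:E
              | d in comp_pert a b eps] @[eps --> 0^'+] --> `|cdiv N w|%:E.
  apply: (first_order _ (`|a| + `|b|) _ comp_small (fun u => `|cdiv u w|)
    _ `|cdiv (const_mx 1) w|) => //.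
  - by move=> u v; exact: cdiv_lipschitz.
  - move=> eps d eps0 /comp_pertE Xd; apply: norm_cdiv_mono => [|i].
      exact: ltW.
    by rewrite NE absmx_mulmx_box.
  - move=> eps eps0; have [Nw0|Nw0] := eqVneq (cdiv N w) 0.
      exists (0, 0).
        by split=> i j; rewrite !mxE normr0 mulr_ge0// ltW.
      rewrite Nw0 normr0 mulr0 sub0r (le_trans _ (normr_ge0 _))//.
      by rewrite oppr_le0 sqr_ge0.
    (* maximize the entry of B v at an index where N / w is largest *)
    have [i Ni] := norm_attained Nw0.
    have [v Xv Bv] := absmx_mulmx_box_attained B e i (ltW eps0).
    exists (usubmx v, dsubmx v).
      by apply/comp_pertE; rewrite /= vsubmxK.
    rewrite /= vsubmxK (@le_trans _ _ (eps * `|cdiv N w|))//.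
      by rewrite lerBlDr lerDl sqr_ge0.
    rewrite Ni (le_trans _ (ler_entry_norm _ i 0))//.
    rewrite [(cdiv N w) i 0]mxE [(cdiv (B *m v) w) i 0]mxE Bv -NE.
    by rewrite !normrM mulrA (gtr0_norm eps0).
have nMx : 0 < `|M *m x| by rewrite normr_gt0.
have n2Mx : 0 < norm2 (M *m x).
  by rewrite (lt_le_trans nMx)// ler_norm_norm2.
have cdiv_const (u : 'cV[R]_l) t : 0 < t -> `|cdiv u (const_mx t)| = `|u| / t.
  move=> t0; rewrite -[t in RHS](gtr0_norm t0) -normfV mulrC -normrZ.
  by congr (`| _ |); apply/matrixP => i j; rewrite (ord1 j) !mxE mulrC.
split.
- have h : mixed_sup lam L M S a b eps @[eps --> 0^'+] -->
      (`|N| / `|M *m x|)%:E.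
    rewrite -cdiv_const//.
    rewrite [X in X @ _](_ : _ = fun eps => ereal_sup
      [set (eps^-1 * `|cdiv (M *m deltax lam L S a b d)
                            (const_mx `|M *m x|)|)%:E
      | d in comp_pert a b eps]); first exact: comp_first_order.
    apply/funext => eps; congr ereal_sup; apply: eq_imagel => d _.
    by rewrite cdiv_const// invfM mulrCA.
  split; first by apply/cvg_ex; exists (`|N| / `|M *m x|)%:E.
  exact: cvg_lim h.
- move=> _; have h := comp_first_order (M *m x).
  split; first by apply/cvg_ex; exists `|cdiv N (M *m x)|%:E.
  exact: cvg_lim h.
- set v := spectral_norm _ * _ / _.
  have h : norm_sup lam L M S a b eps @[eps --> 0^'+] --> v%:E.
    rewrite [X in X @ _](_ : _ = fun eps => ereal_sup
      [set (eps^-1 * (norm2 (M *m deltax lam L S a b d) / norm2 (M *m x)))%:E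
      | d in norm_pert a b eps]); last first.
      apply/funext => eps; congr ereal_sup; apply: eq_imagel => d _.
      by rewrite invfM mulrCA.
    apply: (first_order _ (norm2 e) (norm2_ge0 _) _
      (fun u => norm2 u / norm2 (M *m x)) _ (l%:R / norm2 (M *m x))).
    + move=> eps d eps0; rewrite /norm_pert/= -/e => Xd.
      split; apply: le_trans Xd; apply: le_trans (ler_norm_norm2 _);
        apply: norm_mx_le => // i j.
        by rewrite -(col_mxEu _ d.2) ler_entry_norm.
      by rewrite -(col_mxEd d.1) ler_entry_norm.
    + by rewrite divr_ge0// ltW.
    + move=> u w; rewrite [X in _ + X]mulrAC -mulrDl.
      by rewrite ler_wpM2r ?invr_ge0 ?(ltW n2Mx)// norm2_lipschitz.
    + move=> eps d eps0 Xd; rewrite /v !mulrA ler_wpM2r ?invr_ge0 ?(ltW n2Mx)//.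
      rewrite (le_trans (spectral_norm_ub _ _))//.
      rewrite [eps * _]mulrC -[leRHS]mulrA ler_wpM2l//.
      exact: spectral_norm_ge0.
    + move=> eps eps0; have e1 : 0 < norm2 e + 1.
        by rewrite ltr_wpDl// norm2_ge0.
      (* chosen so that eps * norm2 e * tolerance <= eps^2 * norm2 (M x), also
         without knowing that e != 0 *)
      have tol0 : 0 < eps * norm2 (M *m x) / (norm2 e + 1).
        by rewrite divr_gt0// mulr_gt0.
      have [u u1 hu] := spectral_norm_approx B tol0.
      pose w := (eps * norm2 e) *: u.
      exists (usubmx w, dsubmx w); rewrite /norm_pert/= vsubmxK.
        rewrite norm2Z ger0_norm ?mulr_ge0 ?norm2_ge0 ?(ltW eps0)//.
        by rewrite ler_piMr// mulr_ge0 ?norm2_ge0 ?(ltW eps0).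
      rewrite /w -scalemxAr norm2Z ger0_norm ?mulr_ge0 ?norm2_ge0 ?(ltW eps0)//.
      rewrite ler_pdivlMr// mulrBl /v mulrA divfK ?gt_eqF//.
      have ne0 := norm2_ge0 e.
      set t := eps * norm2 (M *m x) / (norm2 e + 1) in tol0 hu.
      have tE : eps * norm2 (M *m x) = t * (norm2 e + 1).
        by rewrite divfK// gt_eqF.
      rewrite expr2 -(mulrA eps eps) tE.
      have := ler_wpM2l (mulr_ge0 (ltW eps0) ne0) (ltW hu).
      have := mulr_ge0 (ltW eps0) (ltW tol0); nra.
  split; first by apply/cvg_ex; exists v%:E.
  exact: cvg_lim h.
Qed.
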